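(* Let $S$ be a slice of $\mathcal{S}_+^3$. Then $S$ is second-order cone representable (socr) if and only if $\dim(S) \le 4$ or $S = S_B$ for some $B \in \mathcal{S}^3 \setminus \{0\}$ with $\det(B) = 0$.
   Context: $\mathcal{S}^k$ denotes the vector space of real symmetric $k \times k$ matrices, with the trace scalar product $\langle A, B\rangle := \operatorname{tr}(AB)$, and $\mathcal{S}_+^k \subseteq \mathcal{S}^k$ the cone of symmetric positive semidefinite matrices. For a real vector space $V$ and a convex cone $C \subseteq V$, a set $S \subseteq C$ is a slice of $C$ if $S$ is the intersection of $C$ and a linear subspace of $V$. The dimension $\dim(S)$ of a slice is the dimension of its linear hull. For $B \in \mathcal{S}^k$, $S_B := \{A \in \mathcal{S}_+^k : \langle A, B\rangle = 0\}$ (here $k=3$). A set $S$ has a $C$-lift if $S$ is the image of a slice of $C$ under a linear map. Let $\mathcal{Q} := \{x \in \mathbb{R}^3 : x_3 \ge \sqrt{x_1^2 + x_2^2}\}$ be the three-dimensional Lorentz cone and $\mathcal{Q}^m := \mathcal{Q} \times \cdots \times \mathcal{Q}$ ($m$ factors), a convex cone in $(\mathbb{R}^3)^m$. A closed convex cone is second-order cone representable (socr) if it has a $\mathcal{Q}^m$-lift for some positive integer $m$. *)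

(* Defs.v *)
From HB Require Import structures.
From mathcomp Require Import all_boot all_order all_algebra.
From mathcomp Require Import boolp classical_sets reals.

Set Implicit Arguments.
Unset Strict Implicit.
Unset Printing Implicit Defensive.

Import Order.TTheory GRing.Theory Num.Theory.
Local Open Scope classical_set_scope.
Local Open Scope ring_scope.

Section Slices.
Context {R : realType}.
Implicit Types U V : vectType R.

Definition is_slice V (C S : set V) : Prop :=
  exists L : {vspace V}, S = C `&` [set x | x \in L].

Definition is_linear_hull V (S : set V) (L : {vspace V}) : Prop :=
  (forall x, S x -> x \in L) /\
  (forall L' : {vspace V}, (forall x, S x -> x \in L') -> (L <= L')%VS).

Definition linear_hull V (S : set V) : {vspace V} :=
  xget 0%VS [set L | is_linear_hull S L].

(* The default value of [xget] is never used. *)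
Lemma linear_hullP V (S : set V) : is_linear_hull S (linear_hull S).
Proof.
apply: (@xgetPex _ 0%VS [set L | is_linear_hull S L]).
have [|d /asboolP[L SL dL] dmin] := @ex_minnP
    (fun d => `[< exists2 L : {vspace V}, (forall x, S x -> x \in L)
                                        & \dim L = d >]).
  by exists (\dim {:V}); apply/asboolP; exists fullv => // x _; rewrite memvf.
exists L; split=> // L' SL'.
suff /eqP <- : (L :&: L' == L)%VS by exact: capvSr.
rewrite eqEdim capvSl /= dL; apply: dmin; apply/asboolP.
by exists (L :&: L')%VS => // x Sx; rewrite memv_cap SL // SL'.
Qed.

Definition sdim V (S : set V) : nat := \dim (linear_hull S).

Definition has_lift U V (C : set U) (S : set V) : Prop :=
  exists (T : set U) (f : 'Hom(U, V)), is_slice C T /\ S = f @` T.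

End Slices.

Section SecondOrderCone.
Context {R : realType}.

Definition lorentz : set 'rV[R]_3 :=
  [set x : 'rV[R]_3 | Num.sqrt (x 0 0 ^+ 2 + x 0 1 ^+ 2) <= x 0 2].

Definition lorentz_pow (m : nat) : set {ffun 'I_m -> 'rV[R]_3} :=
  [set x : {ffun 'I_m -> 'rV[R]_3} | forall i, lorentz (x i)].

(* Meant for closed convex cones [S]; every slice of the cone [psd] below is
   one. *)
Definition socr (V : vectType R) (S : set V) : Prop :=
  exists2 m : nat, (0 < m)%N & has_lift (@lorentz_pow m) S.

End SecondOrderCone.

Section SymmetricMatrices.
Context {R : realType} {k : nat}.

Definition symv : {vspace 'M[R]_k} := lker (\1 - linfun trmx)%VF.

Lemma mem_symv (A : 'M[R]_k) : (A \in symv) = (A^T == A).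
Proof. by rewrite memv_ker !lfun_simp /= subr_eq0 eq_sym. Qed.

End SymmetricMatrices.

(* The space of symmetric matrices; [vsval] is its inclusion in ['M[R]_k]. *)
Notation sym R k := (subvs_of (@symv R k)).

Section PSD.
Context {R : realType} {k : nat}.

Definition psd : set (sym R k) :=
  [set A : sym R k | forall u : 'rV[R]_k, 0 <= (u *m vsval A *m u^T) 0 0].

Definition trdot (A B : sym R k) : R := \tr (vsval A *m vsval B).

Definition slice_at (B : sym R k) : set (sym R k) :=
  [set A : sym R k | psd A /\ trdot A B = 0].

End PSD.

(* Main.v *)
From HB Require Import structures.
Require Import Defs.
From mathcomp Require Import all_boot all_order all_algebra.
From mathcomp Require Import boolp classical_sets reals.
From mathcomp Require Import zify ring lra.
Local Open Scope classical_set_scope.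
Local Open Scope ring_scope.

Set Implicit Arguments.
Unset Strict Implicit.
Unset Printing Implicit Defensive.
Import Order.TTheory GRing.Theory Num.Theory.

(** Throughout, [Q] is the Lorentz cone and [bil B x y] is the value at [(x, y)]
    of the bilinear form with matrix [B].

    Both halves of the proof are elementary.

    - Sufficiency.  If [B != 0] is singular of size 3, its rank is at most 2, and
      diagonalization turns [tr(AB) = 0] into [bil A p q = 0] for two nonzero
      vectors, as far as semidefinite [A] are concerned ([low_rank_trace0_orth]):
      an indefinite form of rank 2 is a product of two linear forms, and a
      semidefinite one forces [A] to vanish on one of its linear forms.  The cone
      [bil A p q = 0] is the sum of the two faces [p A = 0] and [q A = 0]
      of the semidefinite cone, each of them a linear image of [Q]
      ([socr_psd_orth]).  Since slices of representable cones are representable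
      ([socr_slice]), every slice orthogonal to a nonzero singular matrix is
      representable ([socr_of_singular_orthogonal]).  A slice of dimension
      at most 4 is of this kind: its orthogonal complement contains a pencil of
      symmetric matrices, and a real pencil of odd size has a singular member
      ([singular_in_pencil]).

    - Necessity.  Suppose that a cone [S] of semidefinite matrices contains
      matrices of rank one [v_t^T v_t], [t = 0, 1, ...], such that any two of them
      are cut out among these by a nonnegative functional [A |-> w A w^T].  A lift
      of [S] to [Q^m] is then impossible ([neighbourly_not_socr]).  Indeed, lift
      [v_t^T v_t] to [z_t].  In one factor, infinitely many of the points [z_t]
      lie in the relative interior of the same face of [Q], or infinitely many
      lie in different ones, and two distinct nonzero faces of the strictly convex
      cone [Q] already span an interior point.  In both cases there
      is a subsequence on which any [z_k] is dominated by any two earlier points;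
      extracting [m] times gives [i < j < k] and [c] with
      [c (z_i + z_j) - z_k] in [Q^m].  This point lies on the slice, so its image
      [c (v_i^T v_i + v_j^T v_j) - v_k^T v_k] is semidefinite.  The functional
      that vanishes at [v_i] and [v_j] is negative there, a contradiction.

      The whole cone contains such a family, on the moment curve
      ([psd_not_socr]).  A slice of dimension 5 is [slice_at B]; if [B] is
      nonsingular, it is indefinite because the slice is not zero, and the
      isotropic vectors of [B] form a conic, whose rational parametrization is
      again a moment curve in suitable coordinates ([conic_curve]). *)

(** * Bilinear forms and symmetric matrices *)

Section BilinearForm.
Context {F : fieldType} {n : nat}.
Implicit Types (M N : 'M[F]_n) (x y z p q : 'rV[F]_n) (a : F).

Definition bil M x y : F := (x *m M *m y^T) 0 0.

Lemma bilE M x y : x *m M *m y^T = (bil M x y)%:M.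
Proof. exact: mx11_scalar. Qed.

Lemma bilDl M x y z : bil M (x + y) z = bil M x z + bil M y z.
Proof. by rewrite /bil !mulmxDl mxE. Qed.

Lemma bilDr M x y z : bil M z (x + y) = bil M z x + bil M z y.
Proof. by rewrite /bil linearD /= mulmxDr mxE. Qed.

Lemma bilZl M a x y : bil M (a *: x) y = a * bil M x y.
Proof. by rewrite /bil -!scalemxAl mxE. Qed.

Lemma bilZr M a x y : bil M x (a *: y) = a * bil M x y.
Proof. by rewrite /bil linearZ /= -scalemxAr mxE. Qed.

Lemma bilNl M x y : bil M (- x) y = - bil M x y.
Proof. by rewrite -scaleN1r bilZl mulN1r. Qed.

Lemma bilNr M x y : bil M x (- y) = - bil M x y.
Proof. by rewrite -scaleN1r bilZr mulN1r. Qed.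

Definition bil_lin := (bilDl, bilDr, bilNl, bilNr, bilZl, bilZr).

Lemma bilDm M N x y : bil (M + N) x y = bil M x y + bil N x y.
Proof. by rewrite /bil mulmxDr mulmxDl mxE. Qed.

Lemma bilZm a M x y : bil (a *: M) x y = a * bil M x y.
Proof. by rewrite /bil -scalemxAr -scalemxAl mxE. Qed.

Lemma bilBm M N x y : bil (M - N) x y = bil M x y - bil N x y.
Proof. by rewrite -scaleN1r bilDm bilZm mulN1r. Qed.

Lemma bilC M x y : M^T = M -> bil M x y = bil M y x.
Proof.
move=> sM; rewrite /bil -[in LHS](trmxK (x *m M *m y^T)) [LHS]mxE.
by rewrite !trmx_mul !trmxK sM mulmxA.
Qed.

Lemma bil_rank1 p q x y :
  bil (p^T *m q) x y = (x *m p^T) 0 0 * (q *m y^T) 0 0.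
Proof.
rewrite /bil !mulmxA -(mulmxA (x *m p^T)).
by rewrite [x *m _]mx11_scalar [q *m _]mx11_scalar -scalar_mxM !mxE.
Qed.

Lemma rank1_sym p : (p^T *m p)^T = p^T *m p.
Proof. by rewrite trmx_mul trmxK. Qed.

Lemma mxtrace_rank1 M p q : \tr (M *m (p^T *m q)) = bil M q p.
Proof. by rewrite mulmxA mxtrace_mulC !mulmxA bilE mxtrace_scalar mulr1n. Qed.

Lemma bil_eq0r M x : (forall y, bil M x y = 0) -> x *m M = 0.
Proof.
move=> xM0; apply/rowP => i; rewrite [RHS]mxE -(xM0 (delta_mx 0 i)) /bil.
by rewrite trmx_delta -colE [RHS]mxE.
Qed.

End BilinearForm.

Section Diagonalization.
Context {R : realFieldType} {n : nat}.
Implicit Types (M N : 'M[R]_n) (x y p q : 'rV[R]_n).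

Lemma sym_form_neq0 M : M^T = M -> M != 0 -> exists x, bil M x x != 0.
Proof.
move=> sM; apply: contra_neqP => /forallNP q0.
have {}q0 x : bil M x x = 0 by apply/eqP/negPn/negP/q0.
suff b0 x : x *m M = 0.
  by rewrite -[M]mul1mx; apply/row_matrixP => i; rewrite row_mul b0 row0.
apply: bil_eq0r => y.
by have := q0 (x + y); rewrite !bil_lin !q0 (bilC _ _ sM); lra.
Qed.

Lemma bil_rank1_sqr p x : bil (p^T *m p) x x = (p *m x^T) 0 0 ^+ 2.
Proof. by rewrite bil_rank1 -[x *m _]trmxK trmx_mul trmxK [_^T 0 0]mxE expr2. Qed.

Lemma rank1_psd p x : 0 <= bil (p^T *m p) x x.
Proof. by rewrite bil_rank1_sqr sqr_ge0. Qed.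

(** One step of the diagonalization by completing the square: subtracting the
    square of the linear form [y |-> bil M y x] kills [x] without reviving the
    kernel of [M], so the rank drops.  The last clause, that no new values
    appear, makes semidefiniteness survive the step. *)
Lemma sym_deflate M x : M^T = M -> bil M x x != 0 ->
  let p := x *m M in let N := M - (bil M x x)^-1 *: (p^T *m p) in
  [/\ N^T = N, (\rank N < \rank M)%N &
      forall y, exists z, bil N y y = bil M z z].
Proof.
move=> sM qx p N.
have sN : N^T = N by rewrite /N linearB linearZ /= trmx_mul trmxK sM.
have NE y z : bil N y z = bil M y z - (bil M x x)^-1 * (bil M y x * bil M x z).
  by rewrite bilBm bilZm bil_rank1 /bil trmx_mul sM !mulmxA.
split=> //.
- have xN : x *m N = 0 by apply: bil_eq0r => y; rewrite NE mulrA mulVf // mul1r subrr.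
  have sub : (kermx M + x <= kermx N)%MS.
    rewrite addsmx_sub; apply/andP; split; apply/sub_kermxP => //.
    rewrite /N mulmxBr mulmx_ker -scalemxAr /p trmx_mul sM !mulmxA.
    by rewrite mulmx_ker !mul0mx scaler0 subrr.
  have lt : (kermx M < kermx M + x)%MS.
    rewrite ltmxE addsmxSl /= addsmx_sub submx_refl /=.
    apply: contra qx => /sub_kermxP xM; by rewrite /bil xM mul0mx mxE.
  have := leq_trans (rank_ltmx lt) (mxrankS sub).
  by rewrite !mxrank_ker; have := rank_leq_row M; have := rank_leq_row N; lia.
- move=> y; exists (y - (bil M y x / bil M x x) *: x).
  by rewrite NE !bil_lin (bilC x y sM); field.
Qed.

(** Each coefficient is a value of the form, which gives its sign when [M] is
    semidefinite. *)
Lemma sym_diag M : M^T = M -> exists s : seq (R * 'rV[R]_n),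
  [/\ (size s <= \rank M)%N,
      M = \sum_(cp <- s) cp.1 *: (cp.2^T *m cp.2) &
      forall cp, cp \in s -> exists x, cp.1 = bil M x x].
Proof.
move: {2}(\rank M).+1 (ltnSn (\rank M)) => r.
elim: r M => // r IHr M rM sM.
have [-> | /(sym_form_neq0 sM)[x qx]] := eqVneq M 0.
  by exists [::]; rewrite big_nil.
have [sN rN valN] := sym_deflate sM qx.
have [|s [ss Ns vals]] := IHr _ _ sN; first exact: leq_trans rN _.
exists (((bil M x x)^-1, x *m M) :: s); split.
- exact: leq_ltn_trans ss rN.
- by rewrite big_cons /= -Ns addrC subrK.
- move=> cp; rewrite inE => /predU1P[-> /= | /vals[y ->]]; last exact: valN.
  (* the inverse of the value at [x] is the value at a multiple of [x] *)
  by exists ((bil M x x)^-1 *: x); rewrite !bil_lin; field.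
Qed.

Lemma mxtrace_diag (A : 'M[R]_n) (s : seq (R * 'rV[R]_n)) :
  \tr (A *m \sum_(cp <- s) cp.1 *: (cp.2^T *m cp.2)) =
  \sum_(cp <- s) cp.1 * bil A cp.2 cp.2.
Proof.
rewrite mulmx_sumr linear_sum; apply: eq_bigr => cp _.
by rewrite -scalemxAr linearZ /= mxtrace_rank1.
Qed.

(** This is the degenerate case of the Cauchy-Schwarz inequality: on the line
    [y + a x] the form is affine in [a], and an affine function bounded below is
    constant. *)
Lemma psd_isotropic (A : 'M[R]_n) x : A^T = A -> (forall y, 0 <= bil A y y) ->
  bil A x x = 0 -> x *m A = 0.
Proof.
move=> sA A0 xx; apply: bil_eq0r => y.
have P a : 0 <= bil A y y + 2 * a * bil A x y.
  by have := A0 (y + a *: x); rewrite !bil_lin xx (bilC y x sA); lra.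
apply/eqP/negPn/negP => b0.
have := P (- (bil A y y + 1) / (2 * bil A x y)).
have -> : 2 * (- (bil A y y + 1) / (2 * bil A x y)) * bil A x y =
  - (bil A y y + 1) by field.
by lra.
Qed.

(** Diagonalizing [B] writes the trace as a sum of nonnegative multiples of values
    of [A]; they all vanish, and isotropic vectors of [A] are in its kernel. *)
Lemma psd_trace0 (A B : 'M[R]_n) : A^T = A -> B^T = B ->
  (forall x, 0 <= bil A x x) -> (forall x, 0 <= bil B x x) ->
  \tr (A *m B) = 0 -> B *m A = 0.
Proof.
move=> sA sB A0 B0; have [s [_ Bs vals]] := sym_diag sB.
rewrite [in X in \tr X]Bs mxtrace_diag.
have ge0 cp : cp \in s -> 0 <= cp.1 * bil A cp.2 cp.2.
  by move=> /vals[x ->]; rewrite mulr_ge0.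
rewrite big_seq => /eqP; rewrite psumr_eq0 // => /allP z.
rewrite Bs mulmx_suml big_seq big1 // => cp cps.
move: (z _ cps); rewrite cps mulf_eq0 => /orP[/eqP -> | /eqP /(psd_isotropic sA A0) q0].
  by rewrite scale0r mul0mx.
by rewrite -scalemxAl -mulmxA q0 mulmx0 scaler0.
Qed.

(** Completing the square along [p]; the Cauchy-Schwarz inequality is the
    semidefiniteness of the remainder.  When [bil A p p = 0] the inverse is 0 by
    convention, hence [A2 = 0], which is the right choice as then [p] is in the
    kernel of [A]. *)
Lemma psd_split_kernel (A : 'M[R]_n) p : A^T = A -> (forall y, 0 <= bil A y y) ->
  let A2 := (bil A p p)^-1 *: ((p *m A)^T *m (p *m A)) in
  [/\ (A - A2)^T = A - A2, forall y, 0 <= bil (A - A2) y y & p *m (A - A2) = 0].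
Proof.
move=> sA A0 A2.
have [q0|qn0] := eqVneq (bil A p p) 0.
  by rewrite /A2 q0 invr0 scale0r subr0; split=> //; apply: psd_isotropic.
have [sN _ valN] := sym_deflate sA qn0.
split=> //; first by move=> y; have [z ->] := valN y.
rewrite /A2 mulmxBr -scalemxAr trmx_mul sA !mulmxA bilE mul_scalar_mx -scalemxAl.
by rewrite scalerA mulVf // scale1r subrr.
Qed.
End Diagonalization.

Section SymmetricMatrices.
Context {R : realType} {k : nat}.
Implicit Types (A B : sym R k) (H : {vspace sym R k}).

Lemma sym_tr A : (vsval A)^T = vsval A.
Proof. by apply/eqP; rewrite -mem_symv; exact: subvsP. Qed.

Lemma psdE A : psd A <-> forall x, 0 <= bil (vsval A) x x.
Proof. by []. Qed.

Lemma val_symK (M : 'M[R]_k) : M^T = M -> vsval (vsproj symv M) = M.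
Proof. by move=> sM; rewrite vsprojK // mem_symv sM. Qed.

Lemma trdotC A B : trdot A B = trdot B A.
Proof. exact: mxtrace_mulC. Qed.

Lemma trdot_rank1 A (v : 'rV[R]_k) B : vsval A = v^T *m v ->
  trdot A B = bil (vsval B) v v.
Proof. by move=> Av; rewrite trdotC /trdot Av mxtrace_rank1. Qed.

Lemma trdot_gt0 B : B != 0 -> 0 < trdot B B.
Proof.
move=> B0; have trE : trdot B B = \sum_i \sum_j vsval B i j ^+ 2.
  rewrite /trdot -{2}sym_tr; apply: eq_bigr => i _; rewrite mxE.
  by apply: eq_bigr => j _; rewrite mxE.
have sq0 i j : 0 <= vsval B i j ^+ 2 := sqr_ge0 _.
rewrite lt0r trE !sumr_ge0 ?andbT => [|i _]; last by rewrite sumr_ge0.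
apply: contra_neq B0 => /eqP.
rewrite psumr_eq0 => [/allP z|i _]; last by rewrite sumr_ge0.
apply: val_inj; apply/matrixP => i j; apply/eqP; rewrite mxE -sqrf_eq0.
have := z i (mem_index_enum i).
by rewrite psumr_eq0 // => /allP/(_ j (mem_index_enum j)).
Qed.

Definition trdots m (X : m.-tuple (sym R k)) B : 'rV[R]_m := \row_i trdot B X`_i.

Lemma trdots_linear m (X : m.-tuple (sym R k)) : linear (trdots X).
Proof.
move=> c A B; apply/rowP => i; rewrite !mxE /trdot linearP /=.
by rewrite mulmxDl linearD /= -scalemxAl linearZ.
Qed.
HB.instance Definition _ m (X : m.-tuple (sym R k)) :=
  GRing.isLinear.Build R _ _ _ (trdots X) (trdots_linear X).

(** Rank-nullity for the pairing with a basis of [H]. *)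
Lemma trace_orthogonal H : exists P : {vspace sym R k},
  (forall A B, A \in H -> B \in P -> trdot A B = 0) /\
  (\dim {:sym R k} <= \dim H + \dim P)%N.
Proof.
pose psi := linfun (trdots (vbasis H)); exists (lker psi); split.
  move=> A B AH; rewrite memv_ker lfunE => /eqP /rowP B0.
  rewrite (coord_vbasis AH) trdotC /trdot linear_sum mulmx_sumr linear_sum.
  rewrite big1 //= => i _.
  have := B0 i; rewrite !mxE /trdot => Bi.
  by rewrite -scalemxAr linearZ /= Bi mulr0.
have := limg_ker_dim psi fullv; rewrite capfv => <-.
rewrite addnC leq_add2r; apply: leq_trans (dimvS (subvf _)) _.
by rewrite dimvf /dim /= mul1n.
Qed.

(** If [B] or its opposite were semidefinite, then [B A = 0] by [psd_trace0], and
    [A] would vanish as [B] is invertible. *)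
Lemma slice_at_indefinite B A : \det (vsval B) != 0 -> slice_at B A -> A != 0 ->
  exists x y, 0 < bil (vsval B) x x /\ bil (vsval B) y y < 0.
Proof.
move=> dB [A0 AB] An0.
have uB : vsval B \in unitmx by rewrite unitmxE unitfE.
have sA := sym_tr A; have sB := sym_tr B.
(* the sign [e] treats [B] and [- B] at once *)
have neg e : e ^+ 2 = 1 -> exists y, e * bil (vsval B) y y < 0.
  move=> e2; apply: contrapT => /forallNP e0; case/negP: An0.
  have BA : (e *: vsval B) *m vsval A = 0.
    apply: psd_trace0 => //; first by rewrite linearZ /= sB.
      by move=> x; rewrite bilZm leNgt; apply/negP/e0.
    by rewrite -scalemxAr linearZ /= [\tr _]AB mulr0.
  apply/eqP/val_inj => /=; rewrite -(mulKmx uB (vsval A)).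
  by rewrite -[vsval B *m _]scale1r -e2 expr2 -scalerA scalemxAl BA scaler0 mulmx0.
have [x] := neg (-1) (etrans (sqrrN 1) (expr1n _ _)); have [y] := neg 1 (expr1n _ _).
by rewrite mul1r mulN1r oppr_lt0; exists x, y.
Qed.

End SymmetricMatrices.

(** * Trace-orthogonality to a matrix of low rank *)

Section LowRank.
Context {R : rcfType} {n : nat}.

(** Write [B = a p^T p + b q^T q].  If [a] and [b] do not have opposite
    signs, both terms of the trace vanish for a semidefinite [A] orthogonal to [B],
    so [p] or [q], whichever has a nonzero coefficient, is isotropic for [A].  If
    they have opposite signs, [a X^2 + b Y^2 = a (X + r Y) (X - r Y)] factors over the
    reals. *)
Lemma low_rank_trace0_orth (B : 'M[R]_n) : B^T = B -> B != 0 -> (\rank B <= 2)%N ->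
  exists p q : 'rV[R]_n, [/\ p != 0, q != 0 &
    forall A : 'M[R]_n, A^T = A -> (forall x, 0 <= bil A x x) ->
      \tr (A *m B) = 0 -> bil A p q = 0].
Proof.
move=> sB Bn0 rB; have [s [ss Bs _]] := sym_diag sB.
have s2 : (size s <= 2)%N := leq_trans ss rB.
have [a [b [p [q Bpq]]]] : exists (a b : R) (p q : 'rV[R]_n),
    B = a *: (p^T *m p) + b *: (q^T *m q).
  case: s s2 Bs {ss} => [|[a p] [|[b q] [|//]]] /= _ ->.
  - by exists 0, 0, 0, 0; rewrite big_nil !scale0r addr0.
  - by exists a, 0, p, 0; rewrite big_cons big_nil scale0r.
  - by exists a, b, p, q; rewrite !big_cons big_nil addr0.
have trB A : \tr (A *m B) = a * bil A p p + b * bil A q q.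
  by rewrite Bpq mulmxDr -!scalemxAr linearD !linearZ /= !mxtrace_rank1.
have [ab_ge0|ab_lt0] := leP 0 (a * b).
- have both A : (forall x, 0 <= bil A x x) -> \tr (A *m B) = 0 ->
      a * bil A p p = 0 /\ b * bil A q q = 0.
    move=> A0; rewrite trB => t0.
    have : 0 <= (a * bil A p p) * (b * bil A q q).
      by rewrite mulrACA mulr_ge0 // mulr_ge0.
    by move: t0; split; nra.
  have [ap0|/negbTE ap0] := eqVneq (a *: p) 0.
  + have bq0 : b *: q != 0.
      apply: contra_neq Bn0 => bq0.
      by rewrite Bpq !scalemxAr ap0 bq0 !mulmx0 addr0.
    move: bq0; rewrite scaler_eq0 negb_or => /andP[bn0 qn0].
    exists q, q; split=> // A _ A0 /(both _ A0)[_ /eqP].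
    by rewrite mulf_eq0 (negbTE bn0) => /eqP.
  + move: ap0; rewrite scaler_eq0 => /norP[an0 pn0].
    exists p, p; split=> // A _ A0 /(both _ A0)[/eqP + _].
    by rewrite mulf_eq0 (negbTE an0) => /eqP.
- have an0 : a != 0 by apply: contraTneq ab_lt0 => ->; rewrite mul0r ltxx.
  pose r := Num.sqrt (- (b / a)).
  have br : b = - (a * r ^+ 2).
    rewrite sqr_sqrtr; first by field.
    have -> : - (b / a) = - (a * b) / a ^+ 2 by field.
    by rewrite divr_ge0 ?sqr_ge0 // oppr_ge0 ltW.
  (* if a factor vanishes, then so does [B]; this covers both signs of [r] *)
  have nz (c : R) : c ^+ 2 = r ^+ 2 -> p + c *: q != 0.
    move=> cr; apply: contra_neq Bn0 => /eqP; rewrite addr_eq0 => /eqP pq.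
    have -> : B = (a * c ^+ 2 + b) *: (q^T *m q).
      rewrite Bpq pq -scaleNr [(- c *: q)^T]linearZ /= -scalemxAl -scalemxAr !scalerA.
      by rewrite -scalerDl expr2 -mulrA mulrNN mulrA.
    by rewrite br cr subrr scale0r.
  exists (p + r *: q), (p + (- r) *: q); split; [exact: nz | exact/nz/sqrrN |].
  move=> A sA _; rewrite trB br => t0; apply: (mulfI an0).
  by rewrite !bil_lin mulr0 -[RHS]t0 (bilC p q sA); ring.
Qed.
End LowRank.

(** * The Lorentz cone as the semidefinite cone of size two *)

Lemma ord2_cases (i : 'I_2) : i = 0 \/ i = 1.
Proof. by case: i => [[|[|//]] ?]; [left | right]; apply: val_inj. Qed.

Lemma ord3_cases (i : 'I_3) : [\/ i = 0, i = 1 | i = 2].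
Proof.
by case: i => [[|[|[|//]]] ?]; [constructor 1|constructor 2|constructor 3];
  apply: val_inj.
Qed.

Section LorentzCone.
Context {R : realType}.
Implicit Types (x y z : 'rV[R]_3) (c : R).

Lemma lorentzP x :
  lorentz x <-> 0 <= x 0 2 /\ x 0 0 ^+ 2 + x 0 1 ^+ 2 <= x 0 2 ^+ 2.
Proof.
have x01 : 0 <= x 0 0 ^+ 2 + x 0 1 ^+ 2 by rewrite addr_ge0 ?sqr_ge0.
rewrite /lorentz /=; split=> [le_x | [x2 le_x]].
  have x2 : 0 <= x 0 2 := le_trans (sqrtr_ge0 _) le_x.
  by rewrite -(sqr_sqrtr x01) lerXn2r ?nnegrE ?sqrtr_ge0.
by rewrite -(ger0_norm x2) -sqrtr_sqr ler_wsqrtr.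
Qed.

Lemma lorentzZ c x : 0 <= c -> lorentz x -> lorentz (c *: x).
Proof.
move=> c0 /lorentzP[x2 qx]; apply/lorentzP; rewrite !mxE mulr_ge0 //; split=> //.
by rewrite !exprMn -mulrDr ler_wpM2l ?sqr_ge0.
Qed.

(** The isomorphism of [Q] with the semidefinite cone of size two: the determinant
    of this matrix is the Lorentz form. *)
Definition lorentz_mx x : 'M[R]_2 :=
  \matrix_(i, j) if i == j then if i == 0 then x 0 2 + x 0 0 else x 0 2 - x 0 0
                 else x 0 1.

Lemma lorentz_mx_linear : linear lorentz_mx.
Proof.
by move=> c x y; apply/matrixP => i j; rewrite !mxE; do 2?case: ifP => _ //; ring.
Qed.
HB.instance Definition _ :=
  GRing.isLinear.Build R _ _ _ lorentz_mx lorentz_mx_linear.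

Lemma trmx_lorentz_mx x : (lorentz_mx x)^T = lorentz_mx x.
Proof.
by apply/matrixP => i j; rewrite !mxE eq_sym; case: eqVneq => [->|].
Qed.

Lemma lorentz_mx_surj (M : 'M[R]_2) : M^T = M -> exists x, M = lorentz_mx x.
Proof.
move=> sM; pose x : 'rV[R]_3 := \row_i
  if i == 0 then (M 0 0 - M 1 1) / 2
  else if i == 1 then M 0 1 else (M 0 0 + M 1 1) / 2.
have M10 : M 1 0 = M 0 1 by rewrite -[in LHS]sM mxE.
exists x; apply/matrixP => i j; rewrite !mxE /=.
by case: (ord2_cases i) => ->; case: (ord2_cases j) => -> /=; rewrite ?M10 //; field.
Qed.

Lemma bil_lorentz_mx x (u : 'rV[R]_2) : bil (lorentz_mx x) u u =
  (x 0 2 + x 0 0) * u 0 0 ^+ 2 + 2 * x 0 1 * (u 0 0 * u 0 1)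
  + (x 0 2 - x 0 0) * u 0 1 ^+ 2.
Proof.
rewrite /bil !(mxE, big_ord_recl, big_ord0) /=.
have -> : lift ord0 ord0 = 1 :> 'I_2 by apply: val_inj.
have -> : ord0 = 0 :> 'I_2 by [].
by ring.
Qed.

Lemma lorentz_psd x : lorentz x <-> forall u, 0 <= bil (lorentz_mx x) u u.
Proof.
split=> [/lorentzP[x2 qx] u | psd_x].
  rewrite bil_lorentz_mx; set a := u 0 0; set b := u 0 1.
  have a0 : 0 <= x 0 2 + x 0 0 by nra.
  have [az|an] := eqVneq (x 0 2 + x 0 0) 0.
    have -> : x 0 1 = 0 by apply/eqP; rewrite -sqrf_eq0; apply/eqP; nra.
    by rewrite az; nra.
  rewrite -(pmulr_rge0 _ (_ : 0 < x 0 2 + x 0 0)); last by rewrite lt0r an.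
  have -> : (x 0 2 + x 0 0) * ((x 0 2 + x 0 0) * a ^+ 2 + 2 * x 0 1 * (a * b)
      + (x 0 2 - x 0 0) * b ^+ 2) = ((x 0 2 + x 0 0) * a + x 0 1 * b) ^+ 2 +
      (x 0 2 ^+ 2 - (x 0 0 ^+ 2 + x 0 1 ^+ 2)) * b ^+ 2 by ring.
  by rewrite addr_ge0 ?sqr_ge0 // mulr_ge0 ?sqr_ge0 // subr_ge0.
have P a b : 0 <= (x 0 2 + x 0 0) * a ^+ 2 + 2 * x 0 1 * (a * b)
    + (x 0 2 - x 0 0) * b ^+ 2.
  have := psd_x (\row_i if i == 0 then a else b).
  by rewrite bil_lorentz_mx !mxE.
have P10 := P 1 0; have P01 := P 0 1.
have a0 : 0 <= x 0 2 + x 0 0 by nra.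
have b0 : 0 <= x 0 2 - x 0 0 by nra.
apply/lorentzP; split; first by lra.
have [az|an] := eqVneq (x 0 2 + x 0 0) 0.
  have [x1|x1] := eqVneq (x 0 1) 0; first by rewrite x1; nra.
  (* the form is affine in its first variable, and this value makes it equal -1 *)
  have := P (- (x 0 2 - x 0 0 + 1) / (2 * x 0 1)) 1; rewrite az.
  have -> : 0 * (- (x 0 2 - x 0 0 + 1) / (2 * x 0 1)) ^+ 2 +
     2 * x 0 1 * (- (x 0 2 - x 0 0 + 1) / (2 * x 0 1) * 1) +
     (x 0 2 - x 0 0) * 1 ^+ 2 = - 1 by field.
  by rewrite oppr_ge0 ler10.
(* up to the positive factor [x 0 2 + x 0 0], this value is the determinant *)
have := P (- x 0 1) (x 0 2 + x 0 0); have : 0 < x 0 2 + x 0 0 by rewrite lt0r an.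
move=> ap.
have -> : (x 0 2 + x 0 0) * (- x 0 1) ^+ 2 +
  2 * x 0 1 * (- x 0 1 * (x 0 2 + x 0 0)) +
  (x 0 2 - x 0 0) * (x 0 2 + x 0 0) ^+ 2 = (x 0 2 + x 0 0) *
   (x 0 2 ^+ 2 - (x 0 0 ^+ 2 + x 0 1 ^+ 2)) by ring.
by rewrite pmulr_rge0 // subr_ge0.
Qed.

Lemma lorentzD x y : lorentz x -> lorentz y -> lorentz (x + y).
Proof.
move=> /lorentz_psd Lx /lorentz_psd Ly; apply/lorentz_psd => u.
by rewrite linearD bilDm addr_ge0.
Qed.
End LorentzCone.

(** * Slices orthogonal to a singular matrix *)

Lemma slice_hull (R : realType) (V : vectType R) (C S : set V) : is_slice C S ->
  S = C `&` [set A | A \in linear_hull S].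
Proof.
have [SH minH] := linear_hullP S.
case=> L SE; apply/seteqP; split=> A.
  by move=> SA; split; [move: SA; rewrite SE => -[] | exact: SH].
move=> [A0 /= AH]; rewrite SE; split=> //=; apply: (subvP (minH L _)) => // B.
by rewrite SE => -[].
Qed.

Lemma socr_slice (R : realType) (V : vectType R) (S : set V) (L : {vspace V}) :
  socr S -> socr (S `&` [set x | x \in L]).
Proof.
move=> [m m0 [T [f [[M ->] ->]]]]; exists m => //.
exists (@lorentz_pow R m `&` [set x | x \in (M :&: f @^-1: L)%VS]), f.
split; first by exists (M :&: f @^-1: L)%VS.
apply/seteqP; split=> x /=.
  move=> [[y [Ly My] <-] fyL]; exists y => //; split=> //.
  by rewrite /= memv_cap My -memv_preim.
move=> [y [Ly]]; rewrite memv_cap -memv_preim => /andP[My fyL] <-.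
by split=> //; exists y.
Qed.

Section SumOfFaces.
Context {R : realType}.
Implicit Types (p q : 'rV[R]_3) (A : 'M[R]_3).

Lemma orth_rows p : p != 0 -> exists U : 'M[R]_(2, 3),
  U *m p^T = 0 /\
  forall m (C : 'M[R]_(m, 3)), C *m p^T = 0 -> (C <= U)%MS.
Proof.
move=> p0; have rp : \rank (kermx p^T) = 2%N.
  by rewrite mxrank_ker mxrank_tr rank_rV p0.
have [U eU] : exists U : 'M[R]_(\rank (kermx p^T), 3), (U :=: kermx p^T)%MS.
  by exists (row_base (kermx p^T)); exact: eq_row_base.
rewrite rp in U eU; exists U; split=> //.
  by apply/sub_kermxP; rewrite eU.
by move=> m C /sub_kermxP; rewrite eU.
Qed.

(** The semidefinite matrices killed by [p] are the forms on the plane orthogonal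
    to [p], the row space of [U]; so they form a face that is a copy of the
    semidefinite cone of size two. *)
Lemma psd_face p : p != 0 -> exists U : 'M[R]_(2, 3), U *m p^T = 0 /\
  forall A, A^T = A -> (forall x, 0 <= bil A x x) -> p *m A = 0 ->
  exists2 x, lorentz x & A = U^T *m lorentz_mx x *m U.
Proof.
move=> /orth_rows[U [Up subU]]; exists U; split=> // A sA A0 pA.
have [W AU] : exists W, A *m W *m U = A.
  by exists (pinvmx U); apply/mulmxKpV/subU; rewrite -{1}sA -trmx_mul pA trmx0.
pose M := W^T *m A *m W.
have AU' : U^T *m W^T *m A = A.
  by rewrite -trmx_mul -[X in _ *m X]sA -trmx_mul mulmxA AU sA.
have AM : A = U^T *m M *m U by rewrite /M !mulmxA AU' AU.
have sM : M^T = M by rewrite /M !trmx_mul sA trmxK mulmxA.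
have [x Mx] := lorentz_mx_surj sM.
exists x; last by rewrite -Mx.
apply/lorentz_psd => u; rewrite -Mx.
by have := A0 (u *m W^T); rewrite /bil trmx_mul trmxK !mulmxA.
Qed.

Definition sum_of_faces (U V : 'M[R]_(2, 3)) (x : {ffun 'I_2 -> 'rV[R]_3}) : sym R 3 :=
  vsproj symv (U^T *m lorentz_mx (x 0) *m U + V^T *m lorentz_mx (x 1) *m V).

Lemma sum_of_faces_linear U V : linear (sum_of_faces U V).
Proof.
move=> c x y; rewrite /sum_of_faces !ffunE !linearP /=.
rewrite -[RHS](linearP (@vsproj _ _ symv)).
by rewrite !mulmxDl -!scalemxAl scalerDr addrACA.
Qed.
HB.instance Definition _ U V :=
  GRing.isLinear.Build R _ _ _ (sum_of_faces U V) (sum_of_faces_linear U V).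

Lemma val_sum_of_faces U V x : vsval (sum_of_faces U V x) =
  U^T *m lorentz_mx (x 0) *m U + V^T *m lorentz_mx (x 1) *m V.
Proof.
rewrite /sum_of_faces vsprojK // mem_symv linearD /= !trmx_mul !trmxK.
by rewrite !trmx_lorentz_mx !mulmxA.
Qed.

(** If [p] and [q] are orthogonal for [A], the part of [A] that
    [psd_split_kernel] splits off along [p] is killed by [q], and the remainder is
    killed by [p]. *)
Lemma socr_psd_orth p q : p != 0 -> q != 0 ->
  socr [set A : sym R 3 | psd A /\ bil (vsval A) p q = 0].
Proof.
move=> /psd_face[U [Up surjU]] /psd_face[V [Vq surjV]].
exists 2%N => //; exists (@lorentz_pow R 2), (linfun (sum_of_faces U V)); split.
  by exists fullv; apply/seteqP; split=> x //=; [rewrite memvf | case].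
apply/seteqP; split=> A /=.
- move=> [A0 Apq]; have sA := sym_tr A.
  have [sA1 A10 pA1] := psd_split_kernel p sA A0.
  set A2 := _ *: _ in sA1 A10 pA1.
  have sA2 : A2^T = A2 by rewrite /A2 linearZ /= trmx_mul trmxK.
  have A20 y : 0 <= bil A2 y y.
    by rewrite bilZm mulr_ge0 ?invr_ge0 ?A0 // rank1_psd.
  have qA2 : q *m A2 = 0.
    rewrite /A2 -scalemxAr trmx_mul sA !mulmxA bilE bilC // Apq.
    by rewrite raddf0 !mul0mx scaler0.
  have [x Lx Ax] := surjU _ sA1 A10 pA1.
  have [y Ly Ay] := surjV _ sA2 A20 qA2.
  exists [ffun i => if i == 0 then x else y].
    by move=> i; rewrite ffunE; case: ifP.
  by apply: val_inj; rewrite /= lfunE val_sum_of_faces !ffunE /= -Ax -Ay subrK.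
- move=> [x Lx <-]; rewrite lfunE /= val_sum_of_faces.
  have congrE (W : 'M[R]_(2, 3)) N y z :
      bil (W^T *m N *m W) y z = bil N (y *m W^T) (z *m W^T).
    by rewrite /bil trmx_mul trmxK !mulmxA.
  split.
    apply/psdE => y; rewrite val_sum_of_faces bilDm !congrE.
    by apply: addr_ge0; apply: ((lorentz_psd _).1 (Lx _)).
  rewrite bilDm !congrE /bil.
  have -> : p *m U^T = 0 by rewrite -[p]trmxK -trmx_mul Up trmx0.
  have -> : (q *m V^T)^T = 0 by rewrite trmx_mul trmxK Vq.
  by rewrite !mul0mx mulmx0 !mxE addr0.
Qed.

Lemma socr_of_singular_orthogonal (S : set (sym R 3)) (B : sym R 3) : is_slice psd S ->
  B != 0 -> \det (vsval B) = 0 -> (forall A : sym R 3, S A -> trdot A B = 0) -> socr S.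
Proof.
move=> [L ->] B0 dB SB.
have nB : vsval B != 0 by apply: contra_neq B0 => B0; apply: val_inj.
have rB : (\rank (vsval B) <= 2)%N.
  rewrite -ltnS ltn_neqAle rank_leq_row andbT.
  apply/negP => fB; have : vsval B \in unitmx by rewrite -row_free_unit.
  by rewrite unitmxE dB unitr0.
have [p [q [p0 q0 pq]]] := low_rank_trace0_orth (sym_tr B) nB rB.
have := socr_slice L (socr_psd_orth p0 q0); congr socr.
apply/seteqP; split=> A /= [A0 AL]; split=> //; first by case: A0.
by split=> //; apply: pq (sym_tr A) A0 (SB _ (conj A0 AL)).
Qed.
End SumOfFaces.

(** * Extracting subsequences *)

Section Subsequences.

Lemma ex_chain (r : nat -> nat -> Prop) (n0 : nat) :
  (forall n, exists2 m, (n < m)%N & r n m) ->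
  exists g : nat -> nat, [/\ g 0%N = n0, {homo g : i j / (i < j)%N} &
                             forall i, r (g i) (g i.+1)].
Proof.
move=> rP; have /choice[h hP] : forall n, exists m, (n < m)%N /\ r n m.
  by move=> n; have [m] := rP n; exists m.
exists (fun i => iter i h n0); split=> // [|i]; last by case: (hP (iter i h n0)).
by apply: homo_ltn => [? ? ?|i]; [exact: ltn_trans | case: (hP (iter i h n0))].
Qed.

(** If every value is eventually avoided, one can keep choosing indices beyond
    which the value just taken never returns. *)
Lemma const_or_injective_subseq (T : Type) (f : nat -> T) :
  exists g : nat -> nat, {homo g : i j / (i < j)%N} /\
    ((forall i j, f (g i) = f (g j)) \/ forall i j, (i < j)%N -> f (g i) <> f (g j)).
Proof.
have [[n0 n0P]|fin] := pselect (exists n0, forall n, exists2 m, (n < m)%N & f m = f n0).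
  have [g [_ gmono gP]] := ex_chain n0 n0P.
  exists (g \o succn); split; first by move=> i j ij; exact: gmono.
  by left=> i j /=; rewrite !gP.
have [|g [_ gmono gP]] := @ex_chain (fun n m => forall l, (m <= l)%N -> f l <> f n) 0%N.
  move=> n; have [m mP] : exists m, forall l, (m < l)%N -> f l <> f n.
    apply: contrapT => /forallNP nP; apply: fin; exists n => m.
    have /existsNP[l /not_implyP[ml /contrapT fl]] := nP m.
    by exists l.
  exists (maxn n m).+1; first by rewrite ltnS leq_maxl.
  by move=> l; rewrite gtn_max => /andP[_ ml]; apply: mP.
exists g; split=> //; right=> i j ij; apply/nesym/gP.
by move: ij; rewrite leq_eqVlt => /predU1P[<- //|/gmono/ltnW].
Qed.

End Subsequences.

(** * Domination in powers of the Lorentz cone *)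

Section NeighbourlyCurves.
Context {R : realType}.
Implicit Types (x y z : 'rV[R]_3) (c : R).

(** The smallest face of [Q] that contains [x], for [x] in [Q]. *)
Definition lorentz_face x : set 'rV[R]_3 :=
  [set z | lorentz z /\ exists c, lorentz (c *: x - z)].

Lemma lorentz0 : @lorentz R 0.
Proof. by apply/lorentzP; rewrite !mxE lexx; split=> //; lra. Qed.

Lemma lorentz_face_id x : lorentz x -> lorentz_face x x.
Proof. by move=> Lx; split=> //; exists 1; rewrite scale1r subrr; exact: lorentz0. Qed.

Lemma lorentz_interior x z : lorentz x -> lorentz z ->
  x 0 0 ^+ 2 + x 0 1 ^+ 2 < x 0 2 ^+ 2 -> lorentz_face x z.
Proof.
move=> Lx Lz; split=> //; move: Lx Lz => /lorentzP[x2 qx] /lorentzP[z2 qz].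
pose D := x 0 2 ^+ 2 - (x 0 0 ^+ 2 + x 0 1 ^+ 2).
have D0 : 0 < D by rewrite subr_gt0.
have x2p : 0 < x 0 2.
  rewrite lt0r x2 andbT; apply: contraTneq D0 => x20; rewrite /D x20 -leNgt; nra.
pose b := x 0 2 * z 0 2 - x 0 0 * z 0 0 - x 0 1 * z 0 1.
have b0 : 0 <= b.
  have : (x 0 0 * z 0 0 + x 0 1 * z 0 1) ^+ 2 <= (x 0 2 * z 0 2) ^+ 2.
    have -> : (x 0 0 * z 0 0 + x 0 1 * z 0 1) ^+ 2 =
      (x 0 0 ^+ 2 + x 0 1 ^+ 2) * (z 0 0 ^+ 2 + z 0 1 ^+ 2)
      - (x 0 0 * z 0 1 - x 0 1 * z 0 0) ^+ 2 by ring.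
    rewrite exprMn.
    apply: (@le_trans _ _ ((x 0 0 ^+ 2 + x 0 1 ^+ 2) * (z 0 0 ^+ 2 + z 0 1 ^+ 2))).
      by rewrite gerBl sqr_ge0.
    by rewrite ler_pM ?addr_ge0 ?sqr_ge0.
  have : 0 <= x 0 2 * z 0 2 by rewrite mulr_ge0.
  rewrite /b; move: (x 0 2 * z 0 2) (x 0 0 * z 0 0) (x 0 1 * z 0 1) => s t u.
  by nra.
(* [c ^+ 2 * D - 2 * c * b] is the part of the Lorentz form of [c *: x - z] that
   depends on [c], and this [c] makes it nonnegative *)
pose c := 2 * b / D + z 0 2 / x 0 2.
have c0 : 0 <= c by rewrite addr_ge0 ?divr_ge0 ?mulr_ge0 // ltW.
exists c; apply/lorentzP; rewrite !mxE; split.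
  have -> : c * x 0 2 - z 0 2 = 2 * b / D * x 0 2.
    by rewrite /c; field; rewrite !gt_eqF.
  by rewrite mulr_ge0 ?divr_ge0 ?mulr_ge0 // ltW.
have cD : 0 <= c * (c * D - 2 * b).
  rewrite mulr_ge0 //; have -> : c * D - 2 * b = z 0 2 / x 0 2 * D.
    by rewrite /c; field; rewrite !gt_eqF.
  by rewrite mulr_ge0 ?divr_ge0 // ltW.
rewrite -subr_ge0.
have -> : (c * x 0 2 - z 0 2) ^+ 2 -
    ((c * x 0 0 - z 0 0) ^+ 2 + (c * x 0 1 - z 0 1) ^+ 2) =
    c * (c * D - 2 * b) + (z 0 2 ^+ 2 - (z 0 0 ^+ 2 + z 0 1 ^+ 2)).
  by rewrite /D /b; ring.
by rewrite addr_ge0 // subr_ge0.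
Qed.

Lemma lorentz_faceZ c x : 0 < c -> lorentz_face (c *: x) = lorentz_face x.
Proof.
move=> c0; apply/seteqP; split=> z [Lz [d Ld]]; split=> //.
  by exists (d * c); rewrite -scalerA.
by exists (d / c); rewrite scalerA divfK // gt_eqF.
Qed.

Lemma lorentz_gt0 x : lorentz x -> x != 0 -> 0 < x 0 2.
Proof.
move=> /lorentzP[x2 qx]; rewrite lt0r x2 andbT; apply: contra_neq => x20.
have x0 : x 0 0 = 0 by nra.
have x1 : x 0 1 = 0 by nra.
apply/rowP => i; rewrite mxE.
by case: (ord3_cases i) => ->.
Qed.

(** Strict convexity of [Q]: if [x + y] is not interior, then equality holds in
    the Cauchy-Schwarz inequality for the Lorentz form, so [x] and [y] span the
    same ray. *)
Lemma lorentz_face_add x y z : lorentz x -> lorentz y -> lorentz z ->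
  x != 0 -> y != 0 -> lorentz_face x <> lorentz_face y -> lorentz_face (x + y) z.
Proof.
move=> Lx Ly Lz x0 y0 xy; apply: lorentz_interior => //; first exact: lorentzD.
rewrite ltNge; apply: contra_notN xy; rewrite !mxE => le_xy.
have x2 := lorentz_gt0 Lx x0; have y2 := lorentz_gt0 Ly y0.
move: Lx Ly => /lorentzP[_ qx] /lorentzP[_ qy].
suff -> : y = (y 0 2 / x 0 2) *: x by rewrite lorentz_faceZ // divr_gt0.
(* the squared distance between the points of the two rays at equal height *)
have key : (x 0 2 * y 0 0 - y 0 2 * x 0 0) ^+ 2 +
           (x 0 2 * y 0 1 - y 0 2 * x 0 1) ^+ 2 <= 0.
  have b : x 0 2 * y 0 2 <= x 0 0 * y 0 0 + x 0 1 * y 0 1 by nra.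
  have -> : (x 0 2 * y 0 0 - y 0 2 * x 0 0) ^+ 2 +
           (x 0 2 * y 0 1 - y 0 2 * x 0 1) ^+ 2 =
     x 0 2 ^+ 2 * (y 0 0 ^+ 2 + y 0 1 ^+ 2) + y 0 2 ^+ 2 * (x 0 0 ^+ 2 + x 0 1 ^+ 2)
     - 2 * (x 0 2 * y 0 2) * (x 0 0 * y 0 0 + x 0 1 * y 0 1) by ring.
  have := ler_wpM2l (sqr_ge0 (x 0 2)) qy; have := ler_wpM2l (sqr_ge0 (y 0 2)) qx.
  have := ler_wpM2l (ltW (mulr_gt0 x2 y2)) b.
  nra.
have sq0 (a b : R) : a ^+ 2 + b ^+ 2 <= 0 -> a = 0 /\ b = 0 by split; nra.
have [/eqP + /eqP] := sq0 _ _ key; rewrite !subr_eq0 => /eqP k0 /eqP k1.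
have x2n : x 0 2 != 0 by rewrite gt_eqF.
apply/rowP => i; rewrite mxE; apply: (mulfI x2n).
rewrite mulrA mulrCA divff // mulr1.
by case: (ord3_cases i) => -> //; rewrite mulrC.
Qed.

Lemma lorentz_dominate_mono c d x z : lorentz x -> c <= d ->
  lorentz (c *: x - z) -> lorentz (d *: x - z).
Proof.
move=> Lx cd Lc; have -> : d *: x - z = (d - c) *: x + (c *: x - z).
  by rewrite addrA -scalerDl subrK.
by apply: lorentzD => //; apply: lorentzZ; rewrite // subr_ge0.
Qed.

(** Pigeonhole on the faces generated by the points: either a face recurs
    forever, and it contains all the chosen points, or the faces are pairwise
    distinct and any two of them, apart from the zero face, generate [Q]. *)
Lemma lorentz_dominated_subseq (x : nat -> 'rV[R]_3) : (forall n, lorentz (x n)) ->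
  exists g : nat -> nat, {homo g : i j / (i < j)%N} /\
    forall i j k, (i < j)%N -> (j < k)%N -> lorentz_face (x (g i) + x (g j)) (x (g k)).
Proof.
move=> Lx; have [g [gmono [gc|gi]]] := const_or_injective_subseq (lorentz_face \o x).
  exists g; split=> // i j k _ _; split=> //.
  have [_ [c Lc]] : lorentz_face (x (g i)) (x (g k)).
    by have := gc i k; rewrite /= => ->; exact: lorentz_face_id.
  exists `|c|; have := lorentz_dominate_mono (Lx _) (ler_norm c) Lc.
  move=> /lorentzD/(_ (lorentzZ (normr_ge0 c) (Lx (g j)))).
  by rewrite scalerDr addrAC.
(* the zero face occurs at most once; skip it *)
have [N xN] : exists N, forall n, (N <= n)%N -> x (g n) != 0.
  have [[n xn0]|no0] := pselect (exists n, x (g n) = 0).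
    by exists n.+1 => m nm; apply/eqP => xm0; apply: (gi _ _ nm); rewrite /= xn0 xm0.
  by exists 0%N => n _; apply/eqP => xn0; apply: no0; exists n.
exists (fun i => g (N + i)%N); split.
  by move=> i j ij; apply: gmono; rewrite ltn_add2l.
move=> i j k ij jk; apply: lorentz_face_add; rewrite ?xN ?leq_addr //.
by apply: gi; rewrite ltn_add2l.
Qed.

(** Extract a subsequence for each factor in turn; a constant that works for all
    factors exists because domination only improves when [c] grows. *)
Lemma lorentz_pow_dominated m (z : nat -> {ffun 'I_m -> 'rV[R]_3}) :
  (forall n, lorentz_pow (z n)) ->
  exists i j k c, [/\ (i < j)%N, (j < k)%N & lorentz_pow (c *: (z i + z j) - z k)].
Proof.
move=> Lz.
have [g [gmono gP]] : exists g : nat -> nat, {homo g : i j / (i < j)%N} /\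
    forall a, a \in enum 'I_m -> forall i j k, (i < j)%N -> (j < k)%N ->
      lorentz_face (z (g i) a + z (g j) a) (z (g k) a).
  elim: (enum _) => [|a s [g [gmono gP]]]; first by exists id; split.
  have [h [hmono hP]] :=
    @lorentz_dominated_subseq (fun n => z (g n) a) (fun n => Lz _ a).
  exists (g \o h); split; first by move=> i j ij; exact/gmono/hmono.
  move=> b; rewrite inE => /predU1P[-> //|bs] i j k ij jk.
  by apply: gP => //; exact: hmono.
have /choice[c cP] a : exists c, lorentz (c *: (z (g 0) a + z (g 1) a) - z (g 2) a).
  by have [|_ ] := gP a _ 0%N 1%N 2%N isT isT; rewrite ?mem_enum.
exists (g 0), (g 1), (g 2), (\sum_a `|c a|); split; try exact: gmono.
move=> a; rewrite !ffunE; apply: lorentz_dominate_mono (cP a).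
  exact: lorentzD (Lz _ _) (Lz _ _).
by rewrite (bigD1 a) //= (le_trans (ler_norm _)) // lerDl sumr_ge0.
Qed.

(** The obstruction to second-order representability.  Domination among the lifted
    points would descend to [c (v_i^T v_i + v_j^T v_j) >= v_l^T v_l], which
    evaluation at [w] refutes. *)
Lemma neighbourly_not_socr k (S : set (sym R k)) (v : nat -> 'rV[R]_k) :
  S `<=` psd ->
  (forall t, exists2 A, S A & vsval A = (v t)^T *m v t) ->
  (forall i j l, (i < j)%N -> (j < l)%N -> exists w : 'rV[R]_k,
     [/\ v i *m w^T = 0, v j *m w^T = 0 & v l *m w^T != 0]) ->
  ~ socr S.
Proof.
move=> Spsd Sv vw [m m0 [T [f [[L TE] SE]]]].
have /choice[z zP] (t : nat) : exists z : {ffun 'I_m -> 'rV[R]_3},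
    T z /\ vsval (f z) = (v t)^T *m v t.
  by have [A] := Sv t; rewrite SE => -[z Tz <-] Az; exists z.
have [|i [j [l [c [ij jl Lc]]]]] := @lorentz_pow_dominated m z.
  by move=> t; have [] := zP t; rewrite TE => -[].
have Tc : T (c *: (z i + z j) - z l).
  have zL t : z t \in L by have [] := zP t; rewrite TE => -[].
  by rewrite TE; split=> //=; rewrite rpredB ?rpredZ ?rpredD.
have /Spsd/psdE : S (f (c *: (z i + z j) - z l)).
  by rewrite SE; exists (c *: (z i + z j) - z l).
have [w [wi wj wk]] := vw _ _ _ ij jl.
have fE t : vsval (f (z t)) = (v t)^T *m v t by case: (zP t).
have q t : bil (vsval (f (z t))) w w = ((v t *m w^T) 0 0) ^+ 2.
  by rewrite fE bil_rank1_sqr.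
move/(_ w).
have -> : vsval (f (c *: (z i + z j) - z l)) =
    c *: (vsval (f (z i)) + vsval (f (z j))) - vsval (f (z l)).
  by rewrite linearB linearZ /= [f (_ + _)]linearD.
rewrite bilBm bilZm bilDm !q wi wj.
set a := (v l *m w^T) 0 0; rewrite !mxE expr0n addr0 mulr0 sub0r oppr_ge0.
rewrite le_eqVlt ltNge sqr_ge0 orbF sqrf_eq0 => /eqP a0; move: wk.
by rewrite [v l *m _]mx11_scalar -/a a0 raddf0 eqxx.
Qed.
End NeighbourlyCurves.

(** * Moment curves and conics *)

Section Curves.
Context {R : realType}.
Implicit Types (x y u v w : 'rV[R]_3) (B : 'M[R]_3).

Lemma natr_sub_mul_neq0 (i j k : nat) : (i < j)%N -> (j < k)%N ->
  (k%:R - i%:R) * (k%:R - j%:R) != 0 :> R.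
Proof.
move=> ij jk; rewrite mulf_neq0 // subr_eq0 eqr_nat gtn_eqF //.
exact: ltn_trans jk.
Qed.

Lemma psd_not_socr : ~ socr (@psd R 3).
Proof.
pose v (t : nat) : 'rV[R]_3 := \row_j t%:R ^+ j.
apply: (neighbourly_not_socr (v := v)) => // [t|i j k ij jk].
  exists (vsproj symv ((v t)^T *m v t)); last exact/val_symK/rank1_sym.
  by move=> x; rewrite val_symK ?rank1_sym //; apply: rank1_psd.
(* the coefficients of the polynomial [(X - i) (X - j)] *)
pose w : 'rV[R]_3 := \row_l [:: i%:R * j%:R; - (i%:R + j%:R); 1]`_l.
have vwE (t : nat) : v t *m w^T = ((t%:R - i%:R) * (t%:R - j%:R))%:M.
  rewrite [LHS]mx11_scalar; congr (_%:M).
  by rewrite !(mxE, big_ord_recl, big_ord0) /=; ring.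
exists w; rewrite !vwE !subrr mul0r mulr0 raddf0.
split=> //; apply: contra_neq (natr_sub_mul_neq0 ij jk).
by move=> /rowP/(_ 0); rewrite !mxE.
Qed.

Lemma indefinite_isotropic B x y : B^T = B -> 0 < bil B x x -> bil B y y < 0 ->
  exists2 u, u != 0 & bil B u u = 0.
Proof.
move=> sB qx qy; set a := bil B y y in qy; set c := bil B x x in qx.
pose b := bil B x y; pose r := Num.sqrt (b ^+ 2 - a * c).
have r2 : r ^+ 2 = b ^+ 2 - a * c by rewrite sqr_sqrtr //; nra.
have an : a != 0 by rewrite lt_eqF.
pose s := (r - b) / a.
exists (x + s *: y).
  rewrite addr_eq0 -scaleNr; apply: contraTneq qx => xy.
  rewrite /c xy !bil_lin mulrA mulrNN -expr2 -leNgt.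
  by rewrite mulr_ge0_le0 ?sqr_ge0 // ltW.
rewrite !bil_lin (bilC y x sB) -/a -/b -/c.
transitivity ((r ^+ 2 - (b ^+ 2 - a * c)) / a); first by rewrite /s; field.
by rewrite r2 subrr mul0r.
Qed.

(** Complete the isotropic [u] to a hyperbolic pair [u], [w] and a vector [e]
    orthogonal to both with [bil B e e = c != 0].  In these coordinates the conic
    is [2 X Z + c Y^2 = 0], parametrized by [(- c / 2, t, t^2)]; the test vector is
    the one of the moment curve, transported by [B]. *)
Lemma conic_curve B : B^T = B -> B \in unitmx ->
  (exists2 u, u != 0 & bil B u u = 0) ->
  exists v : nat -> 'rV[R]_3, (forall t, bil B (v t) (v t) = 0) /\
  (forall i j k, (i < j)%N -> (j < k)%N -> exists w : 'rV[R]_3,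
     [/\ v i *m w^T = 0, v j *m w^T = 0 & v k *m w^T != 0]).
Proof.
move=> sB uB [u u0 uu].
have [d ud] : exists d, bil B u d = 1.
  have [d ud] : exists d, bil B u d != 0.
    apply: contra_neqP u0 => /forallNP ud.
    rewrite -(mulmxK uB u) (@bil_eq0r _ _ B u) ?mul0mx //.
    by move=> y; apply/eqP/negPn/negP/ud.
  by exists ((bil B u d)^-1 *: d); rewrite bilZr mulVf.
have [w uw ww] : exists2 w, bil B u w = 1 & bil B w w = 0.
  exists (d - (bil B d d / 2) *: u); rewrite !bil_lin uu ?ud; first by ring.
  by rewrite (bilC d u sB) ud; field.
(* [N] is the form of [B] on the orthogonal complement of [u] and [w]; were it
   zero, the rank of [B] would be at most 2 *)
pose N := B - ((u *m B)^T *m (w *m B) + (w *m B)^T *m (u *m B)).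
have [x Nx] : exists x, bil N x x != 0.
  apply: sym_form_neq0.
    rewrite linearB linearD /= sB; congr (_ - _); rewrite addrC.
    by congr (_ + _); rewrite [LHS]trmx_mul trmxK.
  apply: contraTneq (uB) => /eqP; rewrite subr_eq0 => /eqP BE.
  rewrite -row_free_unit -row_leq_rank -ltnNge.
  have r1 (p q : 'rV[R]_3) : (\rank (p^T *m q) <= 1)%N.
    exact: leq_trans (mxrankM_maxr _ _) (rank_leq_row _).
  rewrite BE; apply: leq_ltn_trans (mxrank_add _ _) _.
  by rewrite ltnS (leq_add (r1 _ _) (r1 _ _)).
have NE : bil N x x = bil B x x - 2 * (bil B x u * bil B x w).
  have e p : (x *m (p *m B)^T) 0 0 = bil B x p by rewrite trmx_mul sB mulmxA.
  have e' p : (p *m B *m x^T) 0 0 = bil B x p by rewrite -/(bil B p x) bilC.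
  by rewrite bilBm bilDm !bil_rank1 !e !e'; ring.
have wu : bil B w u = 1 by rewrite bilC.
have [e [eu ew ee]] : exists e, [/\ bil B e u = 0, bil B e w = 0 & bil B e e != 0].
  exists (x - bil B x w *: u - bil B x u *: w).
  rewrite !bil_lin uu wu uw ww; split; try ring.
  by move: Nx; rewrite NE (bilC u x sB) (bilC w x sB); congr (_ != 0); ring.
pose c := bil B e e; have c0 : c != 0 by [].
pose v (t : nat) := - (c / 2) *: u + t%:R *: e + t%:R ^+ 2 *: w.
exists v; split=> [t|i j k ij jk].
  rewrite !bil_lin (bilC u e sB) (bilC w e sB) eu ew uu ww uw wu -/c.
  by field.
pose z := u - ((i%:R + j%:R) / c) *: e - (2 * (i%:R * j%:R) / c) *: w.
have vz (t : nat) : v t *m (z *m B)^T = ((t%:R - i%:R) * (t%:R - j%:R))%:M.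
  rewrite trmx_mul sB mulmxA bilE; congr (_%:M).
  rewrite !bil_lin (bilC u e sB) (bilC w e sB) eu ew uu ww uw wu -/c.
  by field.
exists (z *m B); rewrite !vz !subrr mul0r mulr0 raddf0.
split=> //; apply: contra_neq (natr_sub_mul_neq0 ij jk).
by move=> /rowP/(_ 0); rewrite !mxE.
Qed.
End Curves.

(** * Dimension count *)

Section Pencil.
Context {R : rcfType} {n : nat}.

(** In odd size the determinant changes sign with the matrix, so signs can be
    chosen such that it goes from nonpositive to nonnegative along a segment
    between multiples of [M] and [N]; then the intermediate value theorem applies. *)
Lemma singular_in_pencil (M N : 'M[R]_n) : odd n ->
  exists a b : R, (a != 0) || (b != 0) /\ \det (a *: M + b *: N) = 0.
Proof.
move=> oddn.
have detN (X : 'M[R]_n) : \det (- X) = - \det X.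
  by rewrite -scaleN1r detZ -signr_odd oddn mulN1r.
have [e [e0 Me]] : exists e : R, e != 0 /\ \det (e *: M) <= 0.
  have [dM|dM] := leP (\det M) 0; first by exists 1; rewrite oner_eq0 scale1r.
  by exists (-1); rewrite oppr_eq0 oner_eq0 scaleN1r detN oppr_le0 ltW.
have [f [f0 Nf]] : exists f : R, f != 0 /\ 0 <= \det (f *: N).
  have [dN|dN] := leP 0 (\det N); first by exists 1; rewrite oner_eq0 scale1r.
  by exists (-1); rewrite oppr_eq0 oner_eq0 scaleN1r detN oppr_ge0 ltW.
pose p := \det (map_mx polyC (e *: M) + 'X *: map_mx polyC (f *: N - e *: M)).
have pE t : p.[t] = \det (e *: M + t *: (f *: N - e *: M)).
  rewrite /p -horner_evalE -det_map_mx; congr (\det _); apply/matrixP => i j.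
  by rewrite !mxE /= horner_evalE !hornerE.
have [|t _ /rootP] := @poly_ivt _ p 0 1 ler01; last first.
  rewrite pE => dt; exists ((1 - t) * e), (t * f); split; last first.
    by rewrite -dt; congr (\det _); apply/matrixP => i j; rewrite !mxE; ring.
  have [->|t0] := eqVneq t 0; first by rewrite subr0 mul1r e0.
  by rewrite (mulf_neq0 t0 f0) orbT.
by rewrite !pE scale0r addr0 scale1r addrC subrK Me Nf.
Qed.
End Pencil.

Section TraceDuality.
Context {R : realType}.
Implicit Types (A B : sym R 3) (H : {vspace sym R 3}).

(** The entries of the antisymmetric part: the symmetric matrices are the kernel
    of this map onto a space of dimension 3, hence have dimension [9 - 3]. *)
Definition skew_part (M : 'M[R]_3) : 'rV[R]_3 :=
  \row_j [:: M 0 1 - M 1 0; M 0 2 - M 2 0; M 1 2 - M 2 1]`_j.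

Lemma skew_part_linear : linear skew_part.
Proof.
move=> c M N; apply/rowP => j; rewrite !mxE.
by case: j => [[|[|[|//]]] ?] /=; ring.
Qed.
HB.instance Definition _ :=
  GRing.isLinear.Build R _ _ _ skew_part skew_part_linear.

Lemma dim_sym3 : \dim {:sym R 3} = 6%N.
Proof.
rewrite dimvf /dim /=.
have kE : @symv R 3 = lker (linfun skew_part).
  apply/vspaceP => M; rewrite mem_symv memv_ker lfunE /=.
  apply/eqP/eqP => [sM|M0]; apply/matrixP => i j; rewrite !mxE.
    have sE k l : M k l = M l k by rewrite -[in LHS]sM mxE.
    by case: (ord3_cases j) => -> /=; apply/eqP; rewrite subr_eq0 sE.
  have := M0; move/rowP => P; have /= := (P 0, P 1, P 2); rewrite !mxE /=.
  move=> [[/subr0_eq P0 /subr0_eq P1] /subr0_eq P2].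
  by case: (ord3_cases i) => ->; case: (ord3_cases j) => ->; rewrite ?P0 ?P1 ?P2.
have fullE : limg (linfun skew_part) = fullv.
  apply/vspaceP => r; rewrite memvf.
  pose M : 'M[R]_3 := \matrix_(i, j)
    (if i == 0 then if j == 1 then r 0 0 else if j == 2 then r 0 1 else 0
     else if (i == 1) && (j == 2) then r 0 2 else 0).
  have -> : r = linfun skew_part M; last exact: memv_img (memvf _).
  rewrite lfunE; apply/rowP => j; rewrite !mxE.
  by case: (ord3_cases j) => -> /=; rewrite subr0.
have := limg_ker_dim (linfun skew_part) fullv.
by rewrite capfv -kE fullE !dimvf => /(@addIn 3 _ 6).
Qed.

Lemma trace_orthogonal_neq0 H : (\dim H < 6)%N ->
  exists2 B, B != 0 & forall A, A \in H -> trdot A B = 0.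
Proof.
move=> H6; have [P [HP]] := trace_orthogonal H; rewrite dim_sym3 => dP.
exists (vpick P); last by move=> A AH; exact: HP AH (memv_pick P).
rewrite vpick0 -dimv_eq0 -lt0n -(ltn_add2l (\dim H)) addn0.
exact: leq_trans H6 dP.
Qed.

Lemma trace_orthogonal_singular H : (\dim H <= 4)%N ->
  exists B, [/\ B != 0, \det (vsval B) = 0 & forall A, A \in H -> trdot A B = 0].
Proof.
move=> H4; have [P [HP]] := trace_orthogonal H; rewrite dim_sym3 => dP.
have {}dP : (1 < \dim P)%N.
  by rewrite -(leq_add2l 4); apply: leq_trans dP _; rewrite leq_add2r.
have P0 : vpick P != 0 by rewrite vpick0 -dimv_eq0 -lt0n ltnW.
have /subvPn[B BP Bn] : ~~ (P <= <[vpick P]>)%VS.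
  by apply/negP => /dimvS; rewrite dim_vline P0 leqNgt dP.
have [a [b [ab dab]]] := @singular_in_pencil R 3 (vsval (vpick P)) (vsval B) isT.
exists (a *: vpick P + b *: B); split.
- apply: contraTneq ab => ab0; rewrite negb_or !negbK.
  have b0 : b = 0.
    apply/eqP/negPn/negP => bn; case/negP: Bn; apply/vlineP.
    exists (- (b^-1 * a)); apply: (scalerI bn).
    rewrite scalerA mulrN mulrA divff // mul1r scaleNr.
    by apply/eqP; rewrite -addr_eq0 addrC ab0.
  move: ab0; rewrite b0 scale0r addr0 => /eqP.
  by rewrite scaler_eq0 (negbTE P0) orbF eqxx => ->.
- by rewrite linearD !linearZ.
- by move=> A AH; apply: HP AH _; rewrite rpredD ?rpredZ ?memv_pick.
Qed.

(** By dimension, the hull is the whole hyperplane orthogonal to [B]. *)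
Lemma hyperplane_slice (S : set (sym R 3)) B : is_slice psd S ->
  (4 < sdim S)%N -> B != 0 -> (forall A, A \in linear_hull S -> trdot A B = 0) ->
  S = slice_at B.
Proof.
move=> /slice_hull SE d5 B0 HB.
pose K := lker (linfun (trdots [tuple B])).
have memK A : A \in K = (trdot A B == 0).
  rewrite memv_ker lfunE /=; apply/eqP/eqP => [/rowP/(_ 0)|AB]; first by rewrite !mxE.
  by apply/rowP => i; rewrite !mxE ord1.
have HK : linear_hull S = K.
  apply/eqP; rewrite eqEdim; apply/andP; split.
    by apply/subvP => A AH; rewrite memK HB.
  apply: leq_trans d5; rewrite -ltnS -dim_sym3 ltn_neqAle dimvS ?subvf // andbT.
  apply: contraTneq (trdot_gt0 B0) => dK.
  have : B \in K.
    by rewrite (_ : K = fullv) ?memvf //; apply/eqP; rewrite eqEdim subvf dK leqnn.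
  by rewrite memK => /eqP ->; rewrite ltxx.
rewrite SE HK; apply/seteqP; split=> A [A0 AB]; split=> //; last by rewrite /= memK AB.
by move: AB; rewrite /= memK => /eqP.
Qed.

Lemma slice_at_not_socr B A : \det (vsval B) != 0 -> slice_at B A -> A != 0 ->
  ~ socr (slice_at B).
Proof.
move=> dB SA A0; have [x [y [qx qy]]] := slice_at_indefinite dB SA A0.
have uB : vsval B \in unitmx by rewrite unitmxE unitfE.
have [v [isov vP]] := conic_curve (sym_tr B) uB (indefinite_isotropic (sym_tr B) qx qy).
apply: neighbourly_not_socr vP => [C []//|t].
have vE := val_symK (rank1_sym (v t)).
exists (vsproj symv ((v t)^T *m v t)) => //.
split; last by rewrite (trdot_rank1 _ vE).
by apply/psdE => z; rewrite vE; apply: rank1_psd.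
Qed.
End TraceDuality.

Theorem theorem1 (R : realType) (S : set (sym R 3)) (hS : is_slice psd S) :
  socr S <->
  (sdim S <= 4)%N \/
  exists B : sym R 3, [/\ B != 0, \det (vsval B) = 0 & S = slice_at B].
Proof.
have [SH _] := linear_hullP S.
split=> [socrS | [d4 | [B [B0 dB SB]]]]; last first.
- by apply: (socr_of_singular_orthogonal hS B0 dB) => A; rewrite SB => -[].
- have [B [B0 dB HB]] := trace_orthogonal_singular d4.
  by apply: (socr_of_singular_orthogonal hS B0 dB) => A /SH; apply: HB.
have [d4|d5] := leqP (sdim S) 4; [by left | right].
have [d6|d6] := ltnP (sdim S) 6; last first.
  case: (@psd_not_socr R); suff <- : S = psd by [].
  have -> : S = psd `&` [set A | A \in linear_hull S] := slice_hull hS.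
  suff -> : linear_hull S = fullv.
    by apply/seteqP; split=> [A []|A A0] //; split=> //=; rewrite memvf.
  by apply/eqP; rewrite eqEdim subvf /= dim_sym3.
have [B B0 HB] := trace_orthogonal_neq0 d6.
have SB := hyperplane_slice hS d5 B0 HB.
exists B; split=> //; apply/eqP/negPn/negP => dB.
have [A SA A0] : exists2 A, S A & A != 0.
  apply: contrapT => S0.
  have /dimvS : (linear_hull S <= 0)%VS.
    apply: (linear_hullP S).2 => A SA; rewrite memv0; apply/negPn/negP => A0.
    by apply: S0; exists A.
  by rewrite dimv0 leqn0 => /eqP d0; move: d5; rewrite /sdim d0.
by rewrite SB in SA socrS; case: (slice_at_not_socr dB SA A0).
Qed.
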